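(* Let $F\subset\mathbb{R}^2$ be a compact convex body, let $\gamma\in C([0,1];\mathbb{R}^2)$ with $\gamma(0)=\gamma(1)=0$, let $\Gamma:=\gamma([0,1])$, and, for $(x,Q)\in F\times O(2)$, define the oppositely transformed boundary $$\mathcal{N}_{x,Q}:=Q^{T}(\partial F-x).$$ Then the following statements are equivalent: (i) $\gamma$ is a diameter-escape path for $F$; (ii) $(x+Q\Gamma)\cap\partial F\neq\varnothing$ for all $(x,Q)\in F\times O(2)$; (iii) $\Gamma\cap\mathcal{N}_{x,Q}\neq\varnothing$ for all $(x,Q)\in F\times O(2)$; (iv) $\min_{t\in[0,1]}\operatorname{dist}(\gamma(t),\mathcal{N}_{x,Q})=0$ for all $(x,Q)\in F\times O(2)$. Consequently, $$D(F)=\min\Big\{\max_{s,t\in[0,1]}\|\gamma(s)-\gamma(t)\| \;:\; \gamma\in C([0,1];\mathbb{R}^2),\ \gamma(0)=\gamma(1)=0,\ \min_{t\in[0,1]}\operatorname{dist}(\gamma(t),\mathcal{N}_{x,Q})=0\ \ \forall (x,Q)\in F\times O(2)\Big\},$$ and this minimum is attained.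
   Context: $O(2)$ is the full orthogonal group of $\mathbb{R}^2$, $\|\cdot\|$ the Euclidean norm, $\operatorname{dist}(p,N)$ the Euclidean distance from a point to a set. A compact convex body is a compact convex set with nonempty interior. A closed path is a continuous map $\gamma:[0,1]\to\mathbb{R}^2$ with $\gamma(0)=\gamma(1)$; its trace is $\Gamma=\gamma([0,1])$ and $\operatorname{diam}\gamma:=\operatorname{diam}\Gamma$. A closed path $\gamma$ is a diameter-escape path for $F$ if $a+Q\Gamma\not\subset\operatorname{int}F$ for every $a\in\mathbb{R}^2$ and $Q\in O(2)$. The critical escape diameter is $D(F):=\inf\{\operatorname{diam}\gamma:\gamma\text{ is a closed diameter-escape path for }F\}$. *)

(* Defs.v *)
From HB Require Import structures.
From mathcomp Require Import all_boot all_order all_algebra.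
From mathcomp Require Import all_classical all_reals all_analysis.

Set Implicit Arguments.
Unset Strict Implicit.
Unset Printing Implicit Defensive.

Import Order.TTheory GRing.Theory Num.Theory.
Import numFieldNormedType.Exports.

Local Open Scope classical_set_scope.
Local Open Scope ring_scope.

Section Plane.
Variable R : realType.

(* The topology, compactness and interior in 'cV[R]_2 are the library's: its
   norm there is the sup norm, which induces the Euclidean topology.  Metric
   quantities (dist, diam) use the Euclidean norm below instead. *)
Local Notation plane := 'cV[R]_2.

Definition enorm (v : plane) : R := Num.sqrt (\sum_(i < 2) v i 0 ^+ 2).

(* [inf set0 = 0]: the value is the distance only when N is nonempty. *)
Definition dist (p : plane) (N : set plane) : R :=
  inf [set enorm (p - y) | y in N].

Definition diam (A : set plane) : R :=
  sup [set enorm (p - q) | p in A & q in A].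

Definition boundary (A : set plane) : set plane := closure A `\` A°.

Definition compact_convex_body (F : set plane) : Prop :=
  [/\ compact F, convex_set F & F° !=set0].

Definition orthogonal_group2 : set 'M[R]_2 := [set Q | Q *m Q^T = 1%:M].

(* Paths are functions on R of which only the restriction to [0, 1] matters. *)
Definition closed_path (gamma : R -> plane) : Prop :=
  {within `[0, 1], continuous gamma} /\ gamma 0 = gamma 1.

Definition trace (gamma : R -> plane) : set plane := gamma @` `[0, 1].

Definition placed (a : plane) (Q : 'M[R]_2) (A : set plane) : set plane :=
  [set a + Q *m p | p in A].

Definition escape_path (F : set plane) (gamma : R -> plane) : Prop :=
  forall a Q, orthogonal_group2 Q -> ~ (placed a Q (trace gamma) `<=` F°).

Definition diameter_escape_path (F : set plane) (gamma : R -> plane) : Prop :=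
  closed_path gamma /\ escape_path F gamma.

(* As [inf set0 = 0], the value is meaningful once F has an escape path, which
   any compact F does. *)
Definition critical_escape_diameter (F : set plane) : R :=
  inf [set diam (trace gamma) | gamma in diameter_escape_path F].

Definition opposite_boundary (F : set plane) (x : plane) (Q : 'M[R]_2) :
  set plane := [set Q^T *m (y - x) | y in boundary F].

Definition based_loop (gamma : R -> plane) : Prop :=
  [/\ {within `[0, 1], continuous gamma}, gamma 0 = 0 & gamma 1 = 0].

Definition is_min (S : set R) (m : R) : Prop := S m /\ lbound S m.
Definition is_max (S : set R) (m : R) : Prop := S m /\ ubound S m.

End Plane.

(* Main.v *)
Require Import Defs.
From HB Require Import structures.
From mathcomp Require Import all_boot all_order all_algebra.
From mathcomp Require Import all_classical all_reals all_analysis.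
From mathcomp Require Import ring lra.
Import Order.TTheory GRing.Theory Num.Theory.
Import numFieldNormedType.Exports.
Local Open Scope classical_set_scope.
Local Open Scope ring_scope.

(** The equivalences rest on connectedness: the copy [x + Q Gamma] contains the
    point [x] of F because the loop starts at 0, so if it leaves the interior
    of F it must cross the boundary.  The rest is a change of variables and the
    fact that the distance to a compact nonempty set vanishes only on that set.

    Attainment of the minimum is the substantial part, since loops of bounded
    diameter are not equicontinuous and a minimizing sequence need not converge.
    The remedy is to replace each loop by a canonical one with the same convex
    hull.  Let K be the closed convex hull of a trace A, and let g be the
    nearest-point projection onto K.  The loop obtained by applying g to a large
    circle has diameter at most that of A.  If a copy of it lay in the interior
    of F, so would the copy of A: a point of A placed outside the interior would
    be strictly separated from the copy of the new loop by a linear form, but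
    that form is maximized over A at some p, and p itself is the projection of a
    point of the circle, namely of a point on the ray that issues from p in the
    direction of the form ([projection_circle_unplaceable]).

    Now the objects to minimize over are the maps g themselves.  They are
    1-Lipschitz and uniformly bounded, so Tychonoff's theorem gives a cluster
    point of any minimizing family in the topology of pointwise convergence.
    The metric bounds pass to the cluster point at once.  So does the escape
    property, because for 1-Lipschitz maps pointwise convergence is uniform on
    the compact circle, and fitting a compact set into an open one is stable
    under small perturbations ([unplaceable_map_limit]).  The limiting map,
    applied to the circle and translated to start at 0, is the minimizer. *)

(** * Euclidean geometry of the plane *)

Lemma ord2_cases (i : 'I_2) : i = 0 \/ i = 1.
Proof. by case: i => -[|[|//]] ?; [left|right]; exact/val_inj. Qed.

Definition dot {R : realType} (u v : 'cV[R]_2) : R := \sum_(i < 2) u i 0 * v i 0.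

Lemma dotE {R : realType} (u v : 'cV[R]_2) :
  dot u v = u 0 0 * v 0 0 + u 1 0 * v 1 0.
Proof.
rewrite /dot 2!big_ord_recl big_ord0 addr0.
by rewrite (_ : lift ord0 ord0 = 1)//; exact/val_inj.
Qed.

Lemma dotC {R : realType} (u v : 'cV[R]_2) : dot u v = dot v u.
Proof. by rewrite !dotE; ring. Qed.

Lemma dotDr {R : realType} (u v w : 'cV[R]_2) : dot u (v + w) = dot u v + dot u w.
Proof. by rewrite !dotE !mxE; ring. Qed.

Lemma dotBr {R : realType} (u v w : 'cV[R]_2) : dot u (v - w) = dot u v - dot u w.
Proof. by rewrite !dotE !mxE; ring. Qed.

Lemma dotZr {R : realType} (u : 'cV[R]_2) k v : dot u (k *: v) = k * dot u v.
Proof. by rewrite !dotE !mxE; ring. Qed.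

Lemma dotDl {R : realType} (u v w : 'cV[R]_2) : dot (u + v) w = dot u w + dot v w.
Proof. by rewrite !(dotC _ w) dotDr. Qed.

Lemma dotZl {R : realType} k (u w : 'cV[R]_2) : dot (k *: u) w = k * dot u w.
Proof. by rewrite !(dotC _ w) dotZr. Qed.

Lemma dot_mulmxl {R : realType} (Q : 'M[R]_2) (u v : 'cV[R]_2) :
  dot (Q *m u) v = dot u (Q^T *m v).
Proof.
have dot_mx (a b : 'cV[R]_2) : dot a b = (a^T *m b) 0 0.
  by rewrite mxE; apply: eq_bigr => i _; rewrite mxE.
by rewrite !dot_mx trmx_mul mulmxA.
Qed.

Lemma dot_ge0 {R : realType} (u : 'cV[R]_2) : 0 <= dot u u.
Proof. by rewrite dotE -!expr2 addr_ge0 ?sqr_ge0. Qed.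

Lemma dot_eq0 {R : realType} (u : 'cV[R]_2) : dot u u = 0 -> u = 0.
Proof.
rewrite dotE -!expr2 => /eqP; rewrite paddr_eq0 ?sqr_ge0// !sqrf_eq0.
move=> /andP[/eqP u0 /eqP u1]; apply/colP => i; rewrite mxE.
by have [->|->] := ord2_cases i.
Qed.

Lemma enormE {R : realType} (u : 'cV[R]_2) : enorm u = Num.sqrt (dot u u).
Proof. by congr Num.sqrt; apply: eq_bigr => i _; rewrite expr2. Qed.

Lemma enorm_ge0 {R : realType} (u : 'cV[R]_2) : 0 <= enorm u.
Proof. exact: sqrtr_ge0. Qed.

Lemma enorm_sqr {R : realType} (u : 'cV[R]_2) : enorm u ^+ 2 = dot u u.
Proof. by rewrite enormE sqr_sqrtr// dot_ge0. Qed.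

Lemma enorm0 {R : realType} : enorm (0 : 'cV[R]_2) = 0.
Proof. by rewrite enormE dotE !mxE !mulr0 addr0 sqrtr0. Qed.

Lemma enorm_eq0 {R : realType} (u : 'cV[R]_2) : enorm u = 0 -> u = 0.
Proof. by move=> u0; apply: dot_eq0; rewrite -enorm_sqr u0 expr0n. Qed.

Lemma enormN {R : realType} (u : 'cV[R]_2) : enorm (- u) = enorm u.
Proof. by rewrite !enormE !dotE !mxE; congr Num.sqrt; ring. Qed.

Lemma enorm_distC {R : realType} (u v : 'cV[R]_2) : enorm (u - v) = enorm (v - u).
Proof. by rewrite -enormN opprB. Qed.

Lemma enorm_le_sqr {R : realType} (u : 'cV[R]_2) k :
  0 <= k -> (enorm u <= k) = (dot u u <= k ^+ 2).
Proof. by move=> k0; rewrite -enorm_sqr ler_sqr ?nnegrE ?enorm_ge0. Qed.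

(** Cauchy-Schwarz, from Lagrange's identity. *)
Lemma dot_le {R : realType} (u v : 'cV[R]_2) : dot u v <= enorm u * enorm v.
Proof.
apply: le_trans (ler_norm _) _.
rewrite -(ler_sqr (normr_ge0 _)) ?nnegrE ?mulr_ge0 ?enorm_ge0// -normrX.
rewrite ger0_norm ?sqr_ge0// exprMn !enorm_sqr !dotE -subr_ge0.
rewrite (_ : _ - _ = (u 0 0 * v 1 0 - u 1 0 * v 0 0) ^+ 2); last by ring.
exact: sqr_ge0.
Qed.

Lemma enormD {R : realType} (u v : 'cV[R]_2) : enorm (u + v) <= enorm u + enorm v.
Proof.
rewrite enorm_le_sqr ?addr_ge0 ?enorm_ge0// sqrrD !enorm_sqr dotDl !dotDr.
rewrite (dotC v u); have := dot_le u v; lra.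
Qed.

Lemma enorm_dist_triangle {R : realType} (v u w : 'cV[R]_2) :
  enorm (u - w) <= enorm (u - v) + enorm (v - w).
Proof. by rewrite -[u - w](subrKA v) enormD. Qed.

Lemma enorm_orthogonal {R : realType} (Q : 'M[R]_2) (u : 'cV[R]_2) :
  orthogonal_group2 Q -> enorm (Q *m u) = enorm u.
Proof.
move=> /mulmx1C QQ; rewrite !enormE dot_mulmxl mulmxA.
by rewrite /orthogonal_group2 /= in QQ; rewrite QQ mul1mx.
Qed.

Lemma coord_le_enorm {R : realType} (u : 'cV[R]_2) i : `|u i 0| <= enorm u.
Proof.
rewrite -ler_sqr ?nnegrE ?enorm_ge0// enorm_sqr -normrX ger0_norm ?sqr_ge0//.
rewrite /dot (bigD1 i)//= expr2 lerDl sumr_ge0// => k _.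
by rewrite -expr2 sqr_ge0.
Qed.

Lemma normr_le_enorm {R : realType} (u : 'cV[R]_2) : `|u| <= enorm u.
Proof.
rewrite [leLHS]/Num.norm/= mx_normrE; apply: bigmax_le => [|[i j] _ /=].
  exact: enorm_ge0.
by rewrite ord1 coord_le_enorm.
Qed.

Lemma enorm_le_normr {R : realType} (u : 'cV[R]_2) : enorm u <= 2 * `|u|.
Proof.
have uij i : `|u i 0| <= `|u|.
  rewrite [leRHS]/Num.norm/= mx_normrE.
  by apply/bigmax_geP; right; exists (i, 0).
rewrite enorm_le_sqr ?mulr_ge0//.
have sq i : u i 0 ^+ 2 <= `|u| ^+ 2.
  by rewrite -[leLHS]ger0_norm ?sqr_ge0// normrX ler_sqr ?nnegrE.
have := sq 0; have := sq 1; rewrite dotE; move: (sqr_ge0 `|u|); rewrite !expr2; lra.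
Qed.

(** The bridge between the ambient topology, which comes from the sup norm, and
    the Euclidean metric in which all estimates are made. *)
Lemma nbhs_enormP {R : realType} (p : 'cV[R]_2) (A : set 'cV[R]_2) :
  nbhs p A <-> exists2 e : R, 0 < e & forall q, enorm (q - p) < e -> A q.
Proof.
split=> [/nbhs_ballP|] [e /= e0 eA].
  exists e => // q qp; apply: eA; rewrite -ball_normE/= -opprB normrN.
  exact: le_lt_trans (normr_le_enorm _) qp.
apply/nbhs_ballP; exists (e / 2) => [/=|q]; first by rewrite divr_gt0.
rewrite -ball_normE/= -opprB normrN => qp; apply: eA.
apply: le_lt_trans (enorm_le_normr _) _.
by rewrite mulrC -ltr_pdivlMr.
Qed.

Lemma continuous_dot {R : realType} (u : 'cV[R]_2) : continuous (dot u).
Proof.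
rewrite (_ : dot u = fun v => u 0 0 * v 0 0 + u 1 0 * v 1 0); last first.
  by apply/funext => v; rewrite dotE.
move=> v; have c i := @coord_continuous R 2 1 i 0 v.
exact: (cvgD (cvgM (cvg_cst _) (c 0)) (cvgM (cvg_cst _) (c 1))).
Qed.

Lemma continuous_enorm {R : realType} : continuous (@enorm R).
Proof.
move=> v; pose f (u : 'cV[R]_2) := u 0 0 * u 0 0 + u 1 0 * u 1 0.
rewrite (_ : @enorm R = fun u => Num.sqrt (f u)); last first.
  by apply/funext => u; rewrite enormE dotE.
apply: (@continuous_comp _ _ _ f); last exact: sqrt_continuous.
have c i := @coord_continuous R 2 1 i 0 v.
exact: (cvgD (cvgM (c 0) (c 0)) (cvgM (c 1) (c 1))).
Qed.

(** Row vectors carry the product topology of their coordinates, so the disk is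
    a closed subset of a transposed compact box. *)
Lemma compact_disk {R : realType} (r : R) : compact [set v : 'cV[R]_2 | enorm v <= r].
Proof.
pose box := [set w : 'rV[R]_2 | forall i, w ord0 i \in `[(- r), r]].
have cbox : compact box.
  apply: (@rV_compact _ _ (fun=> `[(- r), r]%classic)) => _.
  exact: segment_compact.
have ctr : continuous (@trmx R 1 2).
  move=> w A [P Pw PA]; exists (fun i j => P j i) => [i j|z Pz].
    by have := Pw j i; rewrite mxE.
  by apply: PA => i j; rewrite mxE.
have cimg := continuous_compact (continuous_subspaceT ctr) cbox.
apply: (subclosed_compact _ cimg).
  by apply: closed_comp (@closed_le _ r) => v _; exact: continuous_enorm.
move=> v /= vr; exists v^T; last exact: trmxK.
move=> i /=; rewrite mxE in_itv/= -ler_norml; apply: le_trans vr.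
exact: coord_le_enorm.
Qed.

Lemma continuous_enormB {R : realType} (v : 'cV[R]_2) :
  continuous (fun p : 'cV[R]_2 => enorm (p - v)).
Proof.
move=> p; have cB : (fun q : 'cV[R]_2 => q - v) @ p --> p - v.
  exact: (@cvgB _ 'cV[R]_2 _ (nbhs p) _ id (cst v) _ _ cvg_id (cvg_cst v)).
exact: cvg_comp cB (continuous_enorm _).
Qed.

(** * Nearest-point projections and convex hulls *)

Lemma convex_setP {R : realType} (K : set 'cV[R]_2) :
  convex_set K <->
  forall x y t, K x -> K y -> 0 <= t <= 1 -> K (x + t *: (y - x)).
Proof.
have convE (l : {i01 R}) (y x : 'cV[R]_2) :
    conv l (y : convex_lmodType _) x = x + l%:num *: (y - x) :> 'cV[R]_2.
  transitivity (l%:num *: y + (1 - l%:num) *: x) => //.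
  by apply/colP => i; rewrite !mxE; ring.
split=> [cK x y t Kx Ky /andP[t0 t1]|cK x y l].
  rewrite (_ : x + _ = conv (Itv01 t0 t1) (y : convex_lmodType _) x).
    by apply/set_mem/cK; exact/mem_set.
  by rewrite convE.
move=> /set_mem Kx /set_mem Ky; apply/mem_set; rewrite /= convE.
by apply: cK; rewrite ?ge0 ?le1.
Qed.

(** The variational inequality says that the angle at [g v] between [v] and any
    point of K is not acute; for convex K it characterizes the nearest point. *)
Definition is_projection {R : realType} (K : set 'cV[R]_2)
    (g : 'cV[R]_2 -> 'cV[R]_2) : Prop :=
  forall v, K (g v) /\ forall y, K y -> dot (v - g v) (y - g v) <= 0.

(** Take a point p of K nearest to v.  If the inequality failed at y, moving p
    slightly towards y inside K would bring it closer to v. *)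
Lemma exists_projection {R : realType} (K : set 'cV[R]_2) :
  compact K -> convex_set K -> K !=set0 -> exists g, is_projection K g.
Proof.
move=> cptK /convex_setP cK K0.
suff /choice[g gP] v :
    exists p, K p /\ forall y, K y -> dot (v - p) (y - p) <= 0 by exists g.
have cdist : {within K, continuous (fun p => enorm (p - v))}.
  by apply: continuous_subspaceT; exact: continuous_enormB.
have [p /set_mem Kp pmin] := compact_EVT_min K0 cptK cdist.
exists p; split=> // y Ky; rewrite leNgt; apply/negP => c0.
set c := dot _ _ in c0; pose b := dot (y - p) (y - p).
have b0 : 0 <= b by exact: dot_ge0.
have cb : 0 < b + c by exact: ltr_wpDl.
(* The squared distance changes by [- 2 t c + t ^+ 2 b], which is negative for
   this t in (0, 1] because [t * b <= c]. *)
pose t := c / (b + c).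
have tcb : t * (b + c) = c by rewrite divfK// gt_eqF.
have t0 : 0 < t by exact: divr_gt0.
have t1 : t <= 1 by rewrite ler_pdivrMr// mul1r lerDr.
have := pmin (p + t *: (y - p)) (mem_set _).
rewrite enorm_le_sqr ?enorm_ge0// enorm_sqr => /(_ (cK _ _ _ Kp Ky _)).
rewrite ltW//= t1 => /(_ isT).
rewrite [leRHS](_ : _ = dot (p - v) (p - v) - 2 * t * c + t ^+ 2 * b); last first.
  by rewrite /c /b !dotE !mxE; ring.
have : t * (t * (b + c)) = t * c by rewrite tcb.
have := mulr_gt0 t0 c0.
have := mulr_gt0 t0 (mulr_gt0 t0 c0).
rewrite expr2; lra.
Qed.

(** Adding the variational inequality of [g v] tested at [g w] to that of [g w]
    tested at [g v] bounds [|g v - g w|^2] by the inner product of [v - w] and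
    [g v - g w]. *)
Lemma projection_nonexpansive {R : realType} (K : set 'cV[R]_2) g v w :
  is_projection K g -> enorm (g v - g w) <= enorm (v - w).
Proof.
move=> gP; have [Kv gv] := gP v; have [Kw gw] := gP w.
have := enorm_ge0 (g v - g w); rewrite le_eqVlt => /predU1P[<-|gvw0].
  exact: enorm_ge0.
rewrite -(ler_pM2r gvw0) -expr2 enorm_sqr; apply: le_trans (dot_le _ _).
have := gv _ Kw; have := gw _ Kv; rewrite !dotE !mxE; lra.
Qed.

Lemma projection_eq {R : realType} (K : set 'cV[R]_2) g v p :
  is_projection K g -> K p -> (forall y, K y -> dot (v - p) (y - p) <= 0) ->
  g v = p.
Proof.
move=> gP Kp pP; have [Kv gv] := gP v.
apply/eqP; rewrite -subr_eq0; apply/eqP/dot_eq0/le_anti; rewrite dot_ge0 andbT.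
have := gv _ Kp; have := pP _ Kv; rewrite !dotE !mxE; lra.
Qed.

(** The closed convex hull, as the intersection of all closed half-planes that
    contain A.  In this form a linear bound on A is a linear bound on the hull
    by definition, so no theorem on convex combinations is required. *)
Definition halfplane_hull {R : realType} (A : set 'cV[R]_2) : set 'cV[R]_2 :=
  [set x | forall u m, (forall p, A p -> dot u p <= m) -> dot u x <= m].

Lemma sub_halfplane_hull {R : realType} (A : set 'cV[R]_2) : A `<=` halfplane_hull A.
Proof. by move=> x Ax u m; exact. Qed.

Lemma convex_halfplane_hull {R : realType} (A : set 'cV[R]_2) :
  convex_set (halfplane_hull A).
Proof.
apply/convex_setP => x y t Ax Ay /andP[t0 t1] u m Am.
have xm := Ax u m Am; have ym := Ay u m Am.
rewrite dotDr dotZr dotBr.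
have := ler_wpM2l t0 ym; have : (1 - t) * dot u x <= (1 - t) * m.
  by apply: ler_wpM2l => //; rewrite subr_ge0.
lra.
Qed.

Lemma closed_halfplane_hull {R : realType} (A : set 'cV[R]_2) :
  closed (halfplane_hull A).
Proof.
rewrite (_ : halfplane_hull A =
  \bigcap_(um in [set um : 'cV[R]_2 * R | forall p, A p -> dot um.1 p <= um.2])
    [set x | dot um.1 x <= um.2]).
  apply: closed_bigI => -[u m] _ /=.
  by apply: closed_comp (@closed_le _ m) => v _; exact: continuous_dot.
apply/seteqP; split=> x Ax; first by move=> [u m]; exact: Ax.
by move=> u m; exact: (Ax (u, m)).
Qed.

(** With [u := x - y], the number [|u|^2] is the difference of the values of the
    linear form u at x and at y.  These values lie in the range of u over A,
    whose length is at most [d |u|]. *)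
Lemma halfplane_hull_diam {R : realType} (A : set 'cV[R]_2) d : 0 <= d ->
  (forall p q, A p -> A q -> enorm (p - q) <= d) ->
  forall x y, halfplane_hull A x -> halfplane_hull A y -> enorm (x - y) <= d.
Proof.
move=> d0 Ad x y Ax Ay.
have := enorm_ge0 (x - y); rewrite le_eqVlt => /predU1P[<-//|xy0].
rewrite -(ler_pM2l xy0) -expr2 enorm_sqr dotBr lerBlDr.
apply: Ax => p Ap; rewrite -lerBlDl.
have := Ay (- (x - y)) (enorm (x - y) * d - dot (x - y) p).
have dotN (w : 'cV[R]_2) : dot (- (x - y)) w = - dot (x - y) w.
  by rewrite !dotE !mxE; ring.
suff /[swap]/[apply] : forall q, A q ->
    dot (- (x - y)) q <= enorm (x - y) * d - dot (x - y) p by rewrite dotN; lra.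
move=> q Aq; have := dot_le (x - y) (p - q); rewrite dotN dotBr.
have := ler_wpM2l (enorm_ge0 (x - y)) (Ad _ _ Ap Aq); lra.
Qed.

Lemma halfplane_hull_bounded {R : realType} (A : set 'cV[R]_2) r : 0 <= r ->
  (forall p, A p -> enorm p <= r) -> forall x, halfplane_hull A x -> enorm x <= r.
Proof.
move=> r0 Ar x Ax.
have := enorm_ge0 x; rewrite le_eqVlt => /predU1P[<-//|x0].
rewrite -(ler_pM2l x0) -expr2 enorm_sqr; apply: Ax => p Ap.
by apply: le_trans (dot_le _ _) _; rewrite ler_wpM2l ?enorm_ge0 ?Ar.
Qed.

Lemma compact_halfplane_hull {R : realType} (A : set 'cV[R]_2) r : 0 <= r ->
  (forall p, A p -> enorm p <= r) -> compact (halfplane_hull A).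
Proof.
move=> r0 Ar; apply: (subclosed_compact _ (compact_disk r)).
  exact: closed_halfplane_hull.
exact: halfplane_hull_bounded.
Qed.

(** A ray that starts in a disk leaves it: the equation of the crossing is
    quadratic in s, and its larger root is explicit. *)
Lemma ray_meets_circle {R : realType} r (p u : 'cV[R]_2) :
  u != 0 -> enorm p <= r -> exists2 s, 0 <= s & enorm (p + s *: u) = r.
Proof.
move=> u0 pr; have r0 : 0 <= r := le_trans (enorm_ge0 _) pr.
pose a := dot u u; pose b := dot p u; pose c := r ^+ 2 - dot p p.
have a0 : 0 < a.
  rewrite lt_neqAle dot_ge0 andbT eq_sym; apply: contra u0.
  by move=> /eqP /dot_eq0 ->.
have c0 : 0 <= c by rewrite subr_ge0 -enorm_le_sqr.
have D0 : 0 <= b ^+ 2 + a * c by rewrite addr_ge0 ?sqr_ge0// mulr_ge0// ltW.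
pose q := Num.sqrt (b ^+ 2 + a * c).
have q2 : q ^+ 2 = b ^+ 2 + a * c by rewrite sqr_sqrtr.
have bq : b <= q.
  apply: le_trans (ler_norm _) _; rewrite -sqrtr_sqr ler_wsqrtr// lerDl.
  by rewrite mulr_ge0// ltW.
pose s := (q - b) / a; exists s; first by rewrite divr_ge0 ?subr_ge0// ltW.
have sa : s * a = q - b by rewrite divfK// gt_eqF.
apply/eqP; rewrite -(eqrXn2 (ltn0Sn 1)) ?enorm_ge0// enorm_sqr; apply/eqP.
apply: (mulIf (lt0r_neq0 a0)); rewrite dotDl !dotDr !dotZl !dotZr (dotC u p).
rewrite -/a -/b.
transitivity (dot p p * a + 2 * (s * a) * b + (s * a) ^+ 2); first by ring.
rewrite sa.
transitivity (dot p p * a - b ^+ 2 + q ^+ 2); first by ring.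
by rewrite q2 /c; ring.
Qed.

Definition circle {R : realType} (r t : R) : 'cV[R]_2 :=
  \col_i (r * if i == 0 then cos (2 * pi * t) else sin (2 * pi * t)).

Lemma circle_loop {R : realType} (r : R) : circle r 0 = circle r 1.
Proof.
by apply/colP => i; rewrite !mxE mulr0 mulr1 mulr_natl cos2pi sin2pi cos0 sin0.
Qed.

Lemma continuous_circle {R : realType} (r : R) : continuous (circle r).
Proof.
move=> t.
have cf : (fun t : R => 2 * pi * t) @ t --> 2 * pi * t.
  exact: (@cvgM _ _ (nbhs t) _ (cst (2 * pi)) id _ _ (cvg_cst _) cvg_id).
have cij i : (fun t => circle r t i 0) @ t --> circle r t i 0.
  rewrite mxE; under eq_fun do rewrite mxE.
  case: ifP => _; apply: (@cvgM _ _ (nbhs t) _ (cst r) _ _ _ (cvg_cst _)).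
    exact: cvg_comp cf (@continuous_cos R _).
  exact: cvg_comp cf (@continuous_sin R _).
move=> A [P Pt PA].
near=> s; apply: PA => i j; rewrite (ord1 j).
have [-> | ->] := ord2_cases i.
- by near: s; exact: (cij 0 _ (Pt 0 0)).
- by near: s; exact: (cij 1 _ (Pt 1 0)).
Unshelve. all: by end_near. Qed.

(** The polar angle of v, divided by [2 pi]: the arccosine covers the upper
    half-plane, and its reflection the lower one. *)
Lemma circle_surj {R : realType} (r : R) v :
  0 < r -> enorm v = r -> exists2 t, `[0, 1]%classic t & circle r t = v.
Proof.
move=> r0 vr; have rn0 := lt0r_neq0 r0.
have pi20 : 0 < 2 * pi :> R by rewrite mulr_gt0 ?pi_gt0.
pose x := v 0 0 / r; pose y := v 1 0 / r.
have xy : x ^+ 2 + y ^+ 2 = 1.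
  rewrite !expr_div_n -mulrDl !expr2 -dotE -enorm_sqr vr.
  by rewrite -expr2 divff// expf_neq0.
have x1 : -1 <= x <= 1.
  rewrite -ler_norml -(expr_le1 (ltn0Sn 1))// -normrX ger0_norm ?sqr_ge0//.
  by rewrite -xy lerDl sqr_ge0.
have siny : sin (acos x) = `|y|.
  by rewrite sin_acos// -xy addrAC subrr add0r sqrtr_sqr.
have cosx : cos (acos x) = x by rewrite acosK// in_itv.
have t1 : 0 <= acos x / (2 * pi) <= 1.
  rewrite divr_ge0 ?acos_ge0 ?(ltW pi20)//= ler_pdivrMr// mul1r.
  by have := acos_lepi x1; have := @pi_gt0 R; lra.
have vE t : cos (2 * pi * t) = x -> sin (2 * pi * t) = y -> circle r t = v.
  move=> cx sy; apply/colP => i; rewrite mxE cx sy.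
  have [->|->] := ord2_cases i.
  - by rewrite eqxx /x mulrC divfK.
  - by rewrite /= /y mulrC divfK.
have [y0|y0] := leP 0 y.
  exists (acos x / (2 * pi)); first by rewrite /= in_itv/=.
  by apply: vE; rewrite [2 * pi * _]mulrC divfK ?gt_eqF// siny ger0_norm.
exists (1 - acos x / (2 * pi)); first by rewrite /= in_itv/=; lra.
have arg : 2 * pi * (1 - acos x / (2 * pi)) = - acos x + pi *+ 2.
  by rewrite mulrBr mulr1 [2 * pi * (_ / _)]mulrC divfK ?gt_eqF// mulr_natl addrC.
apply: vE; rewrite arg ?cosD2pi ?sinD2pi ?cosN ?sinN// siny ltr0_norm//.
by rewrite opprK.
Qed.

(** * Copies that do not fit into the interior *)

Definition unplaceable {R : realType} (F A : set 'cV[R]_2) : Prop :=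
  forall a Q, orthogonal_group2 Q -> ~ (placed a Q A `<=` F°).

Definition nonexpansive {R : realType} (g : 'cV[R]_2 -> 'cV[R]_2) : Prop :=
  forall v w, enorm (g v - g w) <= enorm (v - w).

Lemma nonexpansive_continuous {R : realType} (g : 'cV[R]_2 -> 'cV[R]_2) :
  nonexpansive g -> continuous g.
Proof.
move=> gP v A /nbhs_enormP[e e0 eA]; apply/nbhs_enormP; exists e => // w wv.
by apply: eA; exact: le_lt_trans (gP _ _) wv.
Qed.

Lemma nonexpansive_placed {R : realType} a Q (g : 'cV[R]_2 -> 'cV[R]_2) :
  orthogonal_group2 Q -> nonexpansive g -> nonexpansive (fun v => a + Q *m g v).
Proof.
move=> oQ gP v w; rewrite opprD addrACA subrr add0r -mulmxBr.
by rewrite enorm_orthogonal.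
Qed.

Lemma compact_circle {R : realType} (r : R) :
  compact [set v : 'cV[R]_2 | enorm v = r].
Proof.
apply: (subclosed_compact _ (compact_disk r)); last by move=> v /= ->.
by apply: closed_comp (@closed_eq _ r) => v _; exact: continuous_enorm.
Qed.

(** Since E is a compact subset of the interior, all its translates by small
    vectors w remain in F, whereas some such translate of q is outside F.
    Separating [q + w] from F by the projection onto F and translating back gives
    a strict inequality, even when q lies on the boundary of F. *)
Lemma interior_separation {R : realType} (F E : set 'cV[R]_2) q :
  compact F -> convex_set F -> compact E -> E `<=` F° -> ~ F° q ->
  exists u, forall e, E e -> dot u e < dot u q.
Proof.
move=> cptF cF cptE EF Fq.
have [F0|nF] := pselect (F !=set0); last first.
  exists 0 => e /EF/interior_subset Fe.
  by exfalso; apply: nF; exists e.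
have [d d0 dE] : exists2 d, 0 < d &
    forall w, enorm w < d -> forall e, E e -> F (e + w).
  have : nbhs (0 : 'cV[R]_2) [set w | E `<=` [set e | F (e + w)]].
    apply: (iffLR (compact_near_coveringP E) cptE _ (nbhs (0 : 'cV[R]_2))
      (fun w e => F (e + w)) _).
    move=> e /EF/nbhs_enormP[d d0 dF].
    exists ([set e' | enorm (e' - e) < d / 2], [set w | enorm (w - 0) < d / 2]).
      by split=> /=; apply/nbhs_enormP; exists (d / 2) => //; exact: divr_gt0.
    move=> [e' w] [/= e'e]; rewrite subr0 => wd; apply: dF.
    rewrite addrAC; apply: le_lt_trans (enormD _ _) _.
    by rewrite [ltRHS]splitr; exact: ltrD.
  move=> /nbhs_enormP[d d0 dE]; exists d => // w wd e Ee.
  by apply: (dE w) => //; rewrite subr0.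
have [w wd Fqw] : exists2 w, enorm w < d & ~ F (q + w).
  apply: contrapT => nw; apply: Fq; apply/nbhs_enormP; exists d => // z zq.
  apply: contrapT => Fz; apply: nw; exists (z - q) => //.
  by rewrite addrC subrK.
have [g gP] := exists_projection _ cptF cF F0.
have [Fg gV] := gP (q + w).
exists (q + w - g (q + w)) => e Ee; have := gV _ (dE _ wd _ Ee).
set z := g _ in Fg gV *.
have : 0 < dot (q + w - z) (q + w - z).
  rewrite lt_neqAle dot_ge0 andbT eq_sym; apply/eqP => /dot_eq0/eqP.
  by rewrite subr_eq0 => /eqP zE; apply: Fqw; rewrite zE.
rewrite !dotE !mxE; lra.
Qed.

(** The linear form u that separates a badly placed point of A from the copy of
    the loop pulls back to a form w.  Let p maximize w over A, hence over the
    hull.  Every point [p + s w] with [s >= 0] projects to p, and one of them is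
    on the circle; so the loop reaches the maximum of w over A, which contradicts
    the strict separation. *)
Lemma projection_circle_unplaceable {R : realType} (F A : set 'cV[R]_2) r g :
  compact F -> convex_set F -> compact A -> (forall p, A p -> enorm p <= r) ->
  is_projection (halfplane_hull A) g -> unplaceable F A ->
  unplaceable F (g @` [set v | enorm v = r]).
Proof.
move=> cptF cF cptA Ar gP nFA a Q oQ sub; apply: (nFA a Q oQ) => _ [p0 Ap0 <-].
apply: contrapT => nFp0.
have gne : nonexpansive g by move=> v w; exact: projection_nonexpansive gP.
have cptE : compact (placed a Q (g @` [set v | enorm v = r])).
  rewrite /placed image_comp; apply: continuous_compact (@compact_circle R r).
  by apply/continuous_subspaceT/nonexpansive_continuous/nonexpansive_placed.
have [u uE] := interior_separation _ _ _ cptF cF cptE sub nFp0.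
have {}uE v : enorm v = r -> dot (Q^T *m u) (g v) < dot (Q^T *m u) p0.
  move=> vr; have := uE (a + Q *m g v).
  rewrite !dot_mulmxl !trmxK !dotDr ltrD2l; apply.
  by exists (g v) => //; exists v.
set w := Q^T *m u in uE.
(* If w vanished the strict inequality would read 0 < 0 at any point of the
   circle; a ray in an arbitrary direction provides such a point. *)
have wn0 : w != 0.
  have e0 : const_mx 1 != 0 :> 'cV[R]_2.
    by apply/eqP => /colP/(_ 0); rewrite !mxE => /eqP; rewrite oner_eq0.
  have [s _ sr] := ray_meets_circle _ _ _ e0 (Ar _ Ap0).
  by apply/eqP => w0; have := uE _ sr; rewrite w0 !dotE !mxE !mul0r ltxx.
have cdot : {within A, continuous (dot w)}.
  by apply: continuous_subspaceT; exact: continuous_dot.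
have [p /set_mem Ap pmax] := compact_EVT_max (ex_intro _ p0 Ap0) cptA cdot.
have [s s0 sr] := ray_meets_circle _ _ _ wn0 (Ar _ Ap).
have := uE _ sr; rewrite (projection_eq _ _ _ p gP).
- by rewrite ltNge pmax// mem_set.
- exact: sub_halfplane_hull.
- move=> y Ay; rewrite addrC addKr dotZl dotBr mulr_ge0_le0// subr_le0.
  by apply: Ay => q Aq; apply: pmax; exact: mem_set.
Qed.

(** The competitors of the compactified minimization problem: the loop is the
    image under g of the circle of radius r, and d bounds its diameter.  The same
    r bounds g, so that the competitors lie in a product of compact disks. *)
Definition unplaceable_map {R : realType} (F : set 'cV[R]_2) (r d : R)
    (g : 'cV[R]_2 -> 'cV[R]_2) : Prop :=
  [/\ nonexpansive g, forall v, enorm (g v) <= r,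
      forall v w, enorm (g v - g w) <= d
    & unplaceable F (g @` [set v | enorm v = r])].

(** The competitor sets for [d > D] are nested, so they generate a filter, and
    by Tychonoff's theorem this filter has a cluster point g for pointwise
    convergence.  Inequalities that involve finitely many values pass to g
    directly.  If the image of the circle under g could be placed in the
    interior of F, then by compactness of the circle so could its image under
    every 1-Lipschitz map h close to g at finitely many points, and some of
    those h are competitors. *)
Lemma unplaceable_map_limit {R : realType} (F : set 'cV[R]_2) (r D : R) :
  (forall d, D < d -> exists g, unplaceable_map F r d g) ->
  exists g, unplaceable_map F r D g.
Proof.
move=> exg.
pose T := prod_topology (fun _ : 'cV[R]_2 => 'cV[R]_2 : topologicalType).
pose B := filter_from [set d | D < d] (fun d => unplaceable_map F r d : set T).
have FB : Filter B.
  apply: filter_from_filter; first by exists (D + 1); rewrite /= ltrDl.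
  move=> d e /= Dd De; exists (Num.min d e); first by rewrite /= lt_min Dd.
  move=> g [g1 g2 g3 g4]; split; split=> // v w; apply: le_trans (g3 v w) _.
    by rewrite ge_min lexx.
  by rewrite ge_min lexx orbT.
have PB : ProperFilter B.
  by apply: filter_from_proper => d /= Dd; exact: exg.
have cptD : compact [set g : T | forall v, enorm (g v) <= r].
  exact: (tychonoff (fun=> @compact_disk R r)).
have BD : B [set g : T | forall v, enorm (g v) <= r].
  by exists (D + 1) => [|g []//]; rewrite /= ltrDl.
have [g [gr clg]] := cptD _ PB BD.
have near_g d (U : set T) : D < d -> nbhs (g : T) U ->
    exists2 h, unplaceable_map F r d h & U h.
  move=> Dd gU; have [h []] := clg _ U (ex_intro2 _ _ d Dd (@subset_refl _ _)) gU.
  by exists h.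
have nbhs_eval v e : 0 < e -> nbhs (g : T) [set h | enorm (h v - g v) < e].
  move=> e0.
  have := @proj_continuous _ (fun _ : 'cV[R]_2 => 'cV[R]_2 : topologicalType) v g.
  move=> /(_ [set z | enorm (z - g v) < e]); apply.
  by apply/nbhs_enormP; exists e.
have approx d e v w : D < d -> 0 < e -> exists2 h, unplaceable_map F r d h &
    enorm (g v - g w) <= enorm (h v - h w) + e.
  move=> Dd e0; have e20 : 0 < e / 2 by exact: divr_gt0.
  have gU : nbhs (g : T)
      [set h | enorm (h v - g v) < e / 2 /\ enorm (h w - g w) < e / 2].
    by apply: (@filterI _ (nbhs (g : T)) _);
      [exact: (nbhs_eval v)|exact: (nbhs_eval w)].
  have [h hd [/= hv hw]] := near_g _ _ Dd gU.
  exists h => //; have := enorm_dist_triangle (h v) (g v) (g w).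
  have := enorm_dist_triangle (h w) (h v) (g w).
  rewrite (enorm_distC (g v) (h v)); lra.
have D1 : D < D + 1 by rewrite ltrDl.
exists g; split=> //.
- move=> v w; apply/ler_addgt0Pr => e e0.
  have [h [h1 _ _ _] ] := approx (D + 1) e v w D1 e0.
  by move/le_trans; apply; rewrite lerD2r.
- move=> v w; apply/ler_addgt0Pr => e e0; have e20 : 0 < e / 2 by exact: divr_gt0.
  have De : D < D + e / 2 by rewrite ltrDl.
  have [h [_ _ h3 _] ] := approx (D + e / 2) (e / 2) v w De e20.
  by move/le_trans; apply; rewrite [in leRHS](splitr e) addrA lerD2r.
- move=> a Q oQ sub.
  have gU : nbhs (g : T) [set h | [set v | enorm v = r] `<=`
      [set v | nonexpansive h -> F° (a + Q *m h v)]].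
    apply: (iffLR (compact_near_coveringP _) (@compact_circle R r) _
      (nbhs (g : T)) (fun h v => nonexpansive h -> F° (a + Q *m h v)) _) => v vr.
    have : nbhs (a + Q *m g v) F°.
      by apply/nbhs_interior/sub; exists (g v) => //; exists v.
    move=> /nbhs_enormP[d d0 dF].
    exists ([set v' | enorm (v' - v) < d / 2], [set h | enorm (h v - g v) < d / 2]).
      split=> /=; last by apply: nbhs_eval; exact: divr_gt0.
      by apply/nbhs_enormP; exists (d / 2) => //; exact: divr_gt0.
    move=> [v' h] [/= v'v hv] hne; apply: dF.
    rewrite opprD addrACA subrr add0r -mulmxBr enorm_orthogonal//.
    apply: le_lt_trans (enorm_dist_triangle (h v) _ _) _.
    by rewrite [ltRHS]splitr; apply: ltrD => //; exact: le_lt_trans (hne _ _) v'v.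
  have [h [h1 _ _ h4] hF] := near_g (D + 1) _ D1 gU.
  by apply: (h4 a Q oQ) => _ [_ [v vr <-] <-]; exact: hF.
Qed.

(** * Diameters, boundaries and distances *)

Lemma compact_enorm_bounded {R : realType} (A : set 'cV[R]_2) :
  compact A -> exists2 r, 0 <= r & forall p, A p -> enorm p <= r.
Proof.
move=> cptA; have [A0|nA] := pselect (A !=set0); last first.
  by exists 0 => // p Ap; exfalso; apply: nA; exists p.
have cnorm : {within A, continuous (@enorm R)}.
  by apply: continuous_subspaceT; exact: continuous_enorm.
have [p _ pmax] := compact_EVT_max A0 cptA cnorm.
by exists (enorm p) => [|q Aq]; [exact: enorm_ge0|exact/pmax/mem_set].
Qed.

Lemma le_diam {R : realType} (A : set 'cV[R]_2) p q :
  compact A -> A p -> A q -> enorm (p - q) <= diam A.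
Proof.
move=> cptA Ap Aq; have [r r0 Ar] := compact_enorm_bounded _ cptA.
apply: ub_le_sup; last by exists p => //; exists q.
exists (r + r) => _ [x Ax [y Ay <-]]; apply: le_trans (enormD _ _) _.
by rewrite enormN lerD ?Ar.
Qed.

Lemma diam_le {R : realType} (A : set 'cV[R]_2) d : A !=set0 ->
  (forall p q, A p -> A q -> enorm (p - q) <= d) -> diam A <= d.
Proof.
move=> [p Ap] Ad; apply: ge_sup; first by exists (enorm (p - p)), p => //; exists p.
by move=> _ [x Ax [y Ay <-]]; exact: Ad.
Qed.

Lemma diam_attained {R : realType} (A : set 'cV[R]_2) : compact A -> A !=set0 ->
  exists p q, [/\ A p, A q & enorm (p - q) = diam A].
Proof.
move=> cptA [x Ax].
have cdist : continuous (fun pq : 'cV[R]_2 * 'cV[R]_2 => enorm (pq.1 - pq.2)).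
  move=> pq; have cB : (fun pq : 'cV[R]_2 * 'cV[R]_2 => pq.1 - pq.2) @ pq -->
      pq.1 - pq.2.
    by apply: (@cvgB _ 'cV[R]_2 _ (nbhs pq) _ fst snd);
      [exact: cvg_fst|exact: cvg_snd].
  exact: cvg_comp cB (continuous_enorm _).
have [] := compact_EVT_max (ex_intro _ (x, x) (conj Ax Ax))
  (compact_setX cptA cptA) (continuous_subspaceT cdist).
move=> [p q] /set_mem[/= Ap Aq] pqmax; exists p, q; split=> //.
apply/le_anti; rewrite le_diam//=; apply: diam_le; first by exists x.
by move=> y z Ay Az; apply: (pqmax (y, z)); exact/mem_set.
Qed.

Lemma compact_trace {R : realType} (gamma : R -> 'cV[R]_2) :
  {within `[0, 1], continuous gamma} -> compact (trace gamma).
Proof. by move=> cg; apply: continuous_compact cg _; exact: segment_compact. Qed.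

Lemma trace_at {R : realType} (gamma : R -> 'cV[R]_2) t :
  0 <= t <= 1 -> trace gamma (gamma t).
Proof. by move=> t01; exists t. Qed.

Lemma trace_start {R : realType} (gamma : R -> 'cV[R]_2) : trace gamma (gamma 0).
Proof. by apply: trace_at; rewrite lexx ler01. Qed.

Lemma diam_trace_ge0 {R : realType} (gamma : R -> 'cV[R]_2) :
  {within `[0, 1], continuous gamma} -> 0 <= diam (trace gamma).
Proof.
move=> cg; apply: le_trans (enorm_ge0 (gamma 0 - gamma 0)) _.
by apply: le_diam; [exact: compact_trace|exact: trace_start|exact: trace_start].
Qed.

Lemma based_loop_closed {R : realType} (gamma : R -> 'cV[R]_2) :
  based_loop gamma -> closed_path gamma.
Proof. by move=> [cg g0 g1]; split=> //; rewrite g0 g1. Qed.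

Lemma is_max_diam_trace {R : realType} (gamma : R -> 'cV[R]_2) d :
  {within `[0, 1], continuous gamma} ->
  is_max [set enorm (gamma p.1 - gamma p.2) | p in `[0, 1] `*` `[0, 1]] d <->
  d = diam (trace gamma).
Proof.
move=> cg; have cptG := compact_trace _ cg.
have G0 : trace gamma !=set0 by exists (gamma 0); exact: trace_start.
have [p [q [[s s01 <-] [t t01 <-] stE]]] := diam_attained _ cptG G0.
split=> [[[[a b] [/= a01 b01] <-] ub]|->].
  apply/le_anti; rewrite le_diam//=; [|by exists a|by exists b].
  by rewrite -stE; apply: ub; exists (s, t).
split; first by exists (s, t).
by move=> _ [[a b] [/= a01 b01] <-]; apply: le_diam => //; [exists a|exists b].
Qed.

Lemma boundaryE {R : realType} (F : set 'cV[R]_2) :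
  closed F -> boundary F = F `\` F°.
Proof. by move=> /closure_id cF; rewrite /boundary -cF. Qed.

Lemma compact_closed_plane {R : realType} (F : set 'cV[R]_2) : compact F -> closed F.
Proof. by apply: compact_closed; exact: norm_hausdorff. Qed.

Lemma compact_boundary {R : realType} (F : set 'cV[R]_2) :
  compact F -> compact (boundary F).
Proof.
move=> cptF; have cF := compact_closed_plane _ cptF.
rewrite boundaryE//; apply: (subclosed_compact _ cptF); last exact: subDsetl.
by apply: closedI => //; apply: open_closedC; exact: open_interior.
Qed.

(** Nonemptiness of the boundary keeps the distance to it from being the
    conventional value 0 of an empty infimum.  A point of F that maximizes the
    sum of the coordinates can be moved out of F by arbitrarily little. *)
Lemma boundary_nonempty {R : realType} (F : set 'cV[R]_2) :
  compact F -> F !=set0 -> boundary F !=set0.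
Proof.
move=> cptF F0; pose w : 'cV[R]_2 := const_mx 1.
have cdot : {within F, continuous (dot w)}.
  by apply: continuous_subspaceT; exact: continuous_dot.
have [p /set_mem Fp pmax] := compact_EVT_max F0 cptF cdot.
exists p; rewrite boundaryE; last exact: compact_closed_plane.
split=> // /nbhs_enormP[e e0 eF].
have Fq : F (p + (e / 2 / 2) *: w).
  apply: eF; rewrite addrAC subrr add0r.
  have e40 : 0 <= e / 2 by rewrite divr_ge0// ltW.
  apply: (@le_lt_trans _ _ (e / 2)); last by rewrite ltr_pdivrMr// ltr_pMr// ltr1n.
  rewrite enorm_le_sqr// dotZl dotZr dotE !mxE.
  by have := sqr_ge0 (e / 2); rewrite !expr2; lra.
have := pmax _ (mem_set Fq); rewrite dotDr dotZr [dot w w]dotE !mxE; lra.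
Qed.

Lemma connected_trace {R : realType} (gamma : R -> 'cV[R]_2) :
  {within `[0, 1], continuous gamma} -> connected (trace gamma).
Proof.
move=> cg; apply: connected_continuous_connected cg; exact: segment_connected.
Qed.

Lemma orthogonal_tr {R : realType} (Q : 'M[R]_2) :
  orthogonal_group2 Q -> Q^T *m Q = 1%:M.
Proof. exact: mulmx1C. Qed.

Lemma placed_continuous {R : realType} a (Q : 'M[R]_2) :
  orthogonal_group2 Q -> continuous (fun p : 'cV[R]_2 => a + Q *m p).
Proof.
by move=> oQ; apply/nonexpansive_continuous/(nonexpansive_placed _ _ id).
Qed.

(** The copy is connected and meets F at x.  If it missed the boundary, the
    part of it in F would be the part in the interior, hence both open and closed
    in the copy, and the whole copy would lie in the interior. *)
Lemma escape_meets_boundary {R : realType} (F : set 'cV[R]_2)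
    (gamma : R -> 'cV[R]_2) x Q :
  closed F -> {within `[0, 1], continuous gamma} -> gamma 0 = 0 ->
  F x -> ~ (placed x Q (trace gamma) `<=` F°) -> orthogonal_group2 Q ->
  placed x Q (trace gamma) `&` boundary F !=set0.
Proof.
move=> cF cg g0 Fx esc oQ; apply: contrapT => nmeet.
have inF p : placed x Q (trace gamma) p -> F p -> F° p.
  move=> Gp Fp; apply: contrapT => nFp; apply: nmeet; exists p.
  by split=> //; rewrite boundaryE.
have Gx : placed x Q (trace gamma) x.
  by exists 0; rewrite ?mulmx0 ?addr0// -g0; exact: trace_start.
have conn : connected (placed x Q (trace gamma)).
  apply: connected_continuous_connected (connected_trace _ cg) _.
  by apply: continuous_subspaceT; exact: placed_continuous.
have GF : placed x Q (trace gamma) `&` F = placed x Q (trace gamma).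
  apply: conn; first by exists x.
  - exists F°; first exact: open_interior.
    apply/seteqP; split=> p [Gp Fp]; split=> //; first exact: inF.
    exact: interior_subset.
  - by exists F.
by apply: esc => p Gp; apply: inF => //; move: Gp; rewrite -GF => -[].
Qed.

Lemma opposite_boundaryP {R : realType} (F : set 'cV[R]_2) x Q p :
  orthogonal_group2 Q -> opposite_boundary F x Q p <-> boundary F (x + Q *m p).
Proof.
move=> oQ; split=> [[y Fy <-]|Fp].
  by rewrite mulmxA oQ mul1mx addrC subrK.
by exists (x + Q *m p) => //; rewrite addrC addKr mulmxA orthogonal_tr// mul1mx.
Qed.

Lemma placed_meets_boundaryP {R : realType} (F A : set 'cV[R]_2) x Q :
  orthogonal_group2 Q ->
  placed x Q A `&` boundary F !=set0 <-> A `&` opposite_boundary F x Q !=set0.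
Proof.
move=> oQ; split=> [[_ [[p Ap <-] Fp]]|[p [Ap /(opposite_boundaryP _ _ _ _ oQ) Fp]]].
  by exists p; split=> //; apply/opposite_boundaryP.
by exists (x + Q *m p); split=> //; exists p.
Qed.

Lemma compact_opposite_boundary {R : realType} (F : set 'cV[R]_2) x Q :
  compact F -> orthogonal_group2 Q -> compact (opposite_boundary F x Q).
Proof.
move=> cptF oQ; apply: continuous_compact (compact_boundary _ cptF).
apply/continuous_subspaceT/nonexpansive_continuous => v w.
rewrite -mulmxBr opprB addrA subrK enorm_orthogonal//.
by rewrite /orthogonal_group2/= trmxK; exact: orthogonal_tr.
Qed.

Lemma dist_ge0 {R : realType} p (N : set 'cV[R]_2) : 0 <= dist p N.
Proof.
rewrite /dist; have [[y Ny]|/nonemptyPn->] := pselect (N !=set0).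
  apply: lb_le_inf; first by exists (enorm (p - y)), y.
  by move=> _ [z _ <-]; exact: enorm_ge0.
by rewrite image_set0 inf0.
Qed.

Lemma dist_eq0 {R : realType} p (N : set 'cV[R]_2) :
  compact N -> N !=set0 -> dist p N = 0 <-> N p.
Proof.
move=> cptN N0; split=> [pN|Np].
  have cdist : {within N, continuous (fun y => enorm (y - p))}.
    by apply: continuous_subspaceT; exact: continuous_enormB.
  have [y /set_mem Ny ymin] := compact_EVT_min N0 cptN cdist.
  have : enorm (y - p) <= dist p N.
    apply: lb_le_inf; first by exists (enorm (p - y)), y.
    by move=> _ [z Nz <-]; rewrite (enorm_distC p); exact/ymin/mem_set.
  rewrite pN => yp.
  have /eqP : y - p = 0 by apply/enorm_eq0/le_anti; rewrite yp enorm_ge0.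
  by rewrite subr_eq0 => /eqP <-.
apply/le_anti; rewrite dist_ge0 andbT -(@enorm0 R) -(subrr p).
apply: ge_inf; last by exists p.
by exists 0 => _ [z _ <-]; exact: enorm_ge0.
Qed.

Lemma min_dist_eq0P {R : realType} (gamma : R -> 'cV[R]_2) N :
  compact N -> N !=set0 ->
  is_min [set dist (gamma t) N | t in `[0, 1]] 0 <-> trace gamma `&` N !=set0.
Proof.
move=> cptN N0; split=> [[[t t01 tN] _]|[_ [[t t01 <-] tN]]].
  by exists (gamma t); split; [exists t|apply/dist_eq0].
split; first by exists t => //; apply/dist_eq0.
by move=> _ [s _ <-]; exact: dist_ge0.
Qed.

(** * Existence of a minimal loop *)

Lemma unplaceable_subset {R : realType} (F A B : set 'cV[R]_2) :
  A `<=` B -> unplaceable F A -> unplaceable F B.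
Proof.
move=> AB nFA a Q oQ BF; apply: (nFA a Q oQ) => _ [p Ap <-].
by apply: BF; exists p => //; exact: AB.
Qed.

Lemma unplaceable_translate {R : realType} (F A : set 'cV[R]_2) c :
  unplaceable F A -> unplaceable F [set p - c | p in A].
Proof.
move=> nFA a Q oQ sub; apply: (nFA (a - Q *m c) Q oQ) => _ [p Ap <-].
apply: sub; exists (p - c); first by exists p.
by rewrite mulmxBr addrA addrAC.
Qed.

Definition image_loop {R : realType} (g : 'cV[R]_2 -> 'cV[R]_2) (r t : R) :
    'cV[R]_2 :=
  g (circle r t) - g (circle r 0).

Lemma based_image_loop {R : realType} (g : 'cV[R]_2 -> 'cV[R]_2) r :
  nonexpansive g -> based_loop (image_loop g r).
Proof.
move=> gP; split.
- have ne : nonexpansive (fun v => g v - g (circle r 0)).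
    by move=> v w; rewrite opprB addrA subrK.
  apply: continuous_subspaceT => t.
  exact: (@cvg_comp _ _ _ (circle r) (fun v => g v - g (circle r 0)) _
    (nbhs (circle r t)) _ (@continuous_circle R r t)
    (nonexpansive_continuous _ ne _)).
- by rewrite /image_loop subrr.
- by rewrite /image_loop -circle_loop subrr.
Qed.

Lemma image_loop_escape {R : realType} (F : set 'cV[R]_2) g r : 0 < r ->
  unplaceable F (g @` [set v | enorm v = r]) -> escape_path F (image_loop g r).
Proof.
move=> r0 /(unplaceable_translate _ _ (g (circle r 0))); apply: unplaceable_subset.
move=> _ [_ [v vr <-] <-].
by have [t t01 <-] := circle_surj _ _ r0 vr; exists t.
Qed.

(** A circle whose radius exceeds that of a disk around F contains two points,
    at the parameters 0 and 1/2, too far apart to be both placed in F. *)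
Lemma compact_has_escape_path {R : realType} (F : set 'cV[R]_2) :
  compact F -> exists gamma, based_loop gamma /\ escape_path F gamma.
Proof.
move=> /compact_enorm_bounded[r r0 Fr]; exists (image_loop id (r + 1)).
split; first by apply: based_image_loop => v w.
move=> a Q oQ sub; set gamma := image_loop _ _ in sub.
have inF t : 0 <= t <= 1 -> enorm (a + Q *m gamma t) <= r.
  move=> t01; apply: Fr; apply: interior_subset; apply: sub.
  by exists (gamma t) => //; exact: trace_at.
have : enorm (gamma (1 / 2)) <= 2 * r.
  rewrite -(enorm_orthogonal _ _ oQ).
  have := enormD (a + Q *m gamma (1 / 2)) (- (a + Q *m gamma 0)).
  rewrite enormN opprD addrACA subrr add0r -mulmxBr.
  rewrite {2}/gamma /image_loop subrr subr0.
  have : 0 <= (1 / 2 : R) <= 1 by lra.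
  have : 0 <= (0 : R) <= 1 by lra.
  by move=> /inF ? /inF ?; lra.
rewrite enorm_le_sqr ?mulr_ge0// dotE !mxE/= mulr0 cos0 sin0.
rewrite (_ : 2 * pi * (1 / 2) = pi); last by field.
rewrite cospi sinpi !expr2; have := mulr_ge0 r0 r0; lra.
Qed.

(** The radius [D + 1] serves all competitors at once: loops of diameter at most
    [D + 1] that are translated to start at 0 lie in the disk of that radius, and
    so do their hulls. *)
Lemma exists_minimal_loop {R : realType} (F : set 'cV[R]_2) :
  compact F -> convex_set F ->
  exists gamma, [/\ based_loop gamma, escape_path F gamma &
    diam (trace gamma) = critical_escape_diameter F].
Proof.
move=> cptF cF; set D := critical_escape_diameter F.
pose S := [set diam (trace gamma) | gamma in diameter_escape_path F].
have lbS : lbound S 0.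
  by move=> _ [gamma [[cg _] _] <-]; exact: diam_trace_ge0.
have infS : has_inf S.
  split; last by exists 0.
  have [gamma [bg eg]] := compact_has_escape_path _ cptF.
  by exists (diam (trace gamma)), gamma => //; split=> //; exact: based_loop_closed.
have D0 : 0 <= D by apply: lb_le_inf lbS; exact: infS.1.
have r0 : 0 < D + 1 by exact: ltr_wpDl.
have [g [gne gr gD gF]] : exists g, unplaceable_map F (D + 1) D g.
  apply: unplaceable_map_limit => d Dd.
  have e0 : 0 < Num.min (d - D) 1 by rewrite lt_min subr_gt0 Dd ltr01.
  have [_ [gamma [[cg _] eg] <-]] := inf_adherent e0 infS.
  rewrite -[inf S]/D => gammaD.
  have cptG := compact_trace _ cg.
  have G0 := trace_start gamma.
  have diamd : diam (trace gamma) <= d.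
    apply/ltW/(lt_le_trans gammaD); rewrite -lerBrDl.
    by rewrite ge_min lexx.
  have diamr : diam (trace gamma) <= D + 1.
    apply/ltW/(lt_le_trans gammaD); rewrite lerD2l.
    by rewrite ge_min lexx orbT.
  pose A := [set p - gamma 0 | p in trace gamma].
  have cptA : compact A.
    apply: continuous_compact cptG; apply/continuous_subspaceT.
    by apply: nonexpansive_continuous => v w; rewrite opprB addrA subrK.
  have Ar p : A p -> enorm p <= D + 1.
    by move=> [q Gq <-]; apply: le_trans diamr; exact: le_diam.
  have Ad p q : A p -> A q -> enorm (p - q) <= d.
    move=> [p' Gp <-] [q' Gq <-]; rewrite opprB addrA subrK.
    by apply: le_trans diamd; exact: le_diam.
  have [|||g gP] := exists_projection (halfplane_hull A).
  - exact: compact_halfplane_hull (ltW r0) Ar.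
  - exact: convex_halfplane_hull.
  - by exists (gamma 0 - gamma 0); apply: sub_halfplane_hull; exists (gamma 0).
  exists g; split.
  - by move=> v w; exact: projection_nonexpansive gP.
  - by move=> v; apply: (halfplane_hull_bounded _ _ (ltW r0) Ar); exact: (gP v).1.
  - move=> v w; apply: (halfplane_hull_diam _ _ _ Ad); last 2 first.
    + exact: (gP v).1.
    + exact: (gP w).1.
    + exact: le_trans (ltW Dd).
  - apply: projection_circle_unplaceable gP _ => //.
    exact: unplaceable_translate.
have bg := based_image_loop _ (D + 1) gne.
have eg := image_loop_escape _ _ _ r0 gF.
exists (image_loop g (D + 1)); split=> //; apply/le_anti/andP; split.
  apply: diam_le.
    by exists (image_loop g (D + 1) 0); exact: trace_start.
  by move=> _ _ [s _ <-] [t _ <-]; rewrite opprB addrA subrK.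
apply: ge_inf; first by exists 0.
by exists (image_loop g (D + 1)) => //; split=> //; exact: based_loop_closed.
Qed.

Theorem theorem5 (R : realType) (F : set 'cV[R]_2) (hF : compact_convex_body F) :
  (forall gamma : R -> 'cV[R]_2, based_loop gamma ->
    [<-> diameter_escape_path F gamma;
         forall x Q, F x -> orthogonal_group2 Q ->
           placed x Q (trace gamma) `&` boundary F !=set0;
         forall x Q, F x -> orthogonal_group2 Q ->
           trace gamma `&` opposite_boundary F x Q !=set0;
         forall x Q, F x -> orthogonal_group2 Q ->
           is_min [set dist (gamma t) (opposite_boundary F x Q)
                  | t in `[0, 1]] 0]) /\
  is_min
    [set d | exists gamma : R -> 'cV[R]_2,
      [/\ based_loop gamma,
          forall x Q, F x -> orthogonal_group2 Q ->
            is_min [set dist (gamma t) (opposite_boundary F x Q)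
                   | t in `[0, 1]] 0
        & is_max [set enorm (gamma p.1 - gamma p.2)
                 | p in `[0, 1] `*` `[0, 1]] d]]
    (critical_escape_diameter F).
Proof.
have [cptF cF iF0] := hF.
have F0 : F !=set0 by case: iF0 => x /interior_subset; exists x.
have minP gamma x Q : orthogonal_group2 Q ->
    is_min [set dist (gamma t) (opposite_boundary F x Q) | t in `[0, 1]] 0 <->
    trace gamma `&` opposite_boundary F x Q !=set0.
  move=> oQ; apply: min_dist_eq0P; first exact: compact_opposite_boundary.
  by have [y Fy] := boundary_nonempty _ cptF F0; exists (Q^T *m (y - x)), y.
have equiv gamma : based_loop gamma ->
    [<-> diameter_escape_path F gamma;
         forall x Q, F x -> orthogonal_group2 Q ->
           placed x Q (trace gamma) `&` boundary F !=set0;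
         forall x Q, F x -> orthogonal_group2 Q ->
           trace gamma `&` opposite_boundary F x Q !=set0;
         forall x Q, F x -> orthogonal_group2 Q ->
           is_min [set dist (gamma t) (opposite_boundary F x Q)
                  | t in `[0, 1]] 0].
  move=> [cg g0 g1]; tfae.
  - move=> [_ eg] x Q Fx oQ.
    by apply: escape_meets_boundary (eg x Q oQ) oQ => //; exact: compact_closed_plane.
  - by move=> mb x Q Fx oQ; apply/(placed_meets_boundaryP _ _ _ _ oQ)/mb.
  - by move=> mN x Q Fx oQ; apply/minP/mN.
  - move=> minN; split; first exact: based_loop_closed.
    move=> a Q oQ sub.
    have Fa : F a.
      apply: interior_subset; apply: sub; exists (gamma 0); first exact: trace_start.
      by rewrite g0 mulmx0 addr0.
    have /(minP _ _ _ oQ) := minN a Q Fa oQ.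
    move=> /(placed_meets_boundaryP _ _ _ _ oQ)[p [/sub Fp]].
    by rewrite boundaryE => [[]|]; last exact: compact_closed_plane.
split=> //; split.
  have [gamma [bg eg gD]] := exists_minimal_loop _ cptF cF.
  have [cg g0 g1] := bg; exists gamma; split=> //; last by apply/is_max_diam_trace.
  by apply: ((equiv _ bg) 0%N 3%N).1; split=> //; exact: based_loop_closed.
move=> d [gamma [bg minN]]; have [cg _ _] := bg.
move=> /(is_max_diam_trace _ _ cg) ->; apply: ge_inf.
  by exists 0 => _ [eta [[ce _] _] <-]; exact: diam_trace_ge0.
by exists gamma => //; apply: ((equiv _ bg) 3%N 0%N).1.
Qed.
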